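(* Let $m$ be a positive integer and let $G$ be a graph on $n$ vertices containing no induced subgraph isomorphic to $K_{1,m+1}$. Let $(x,y)$ be an $\left(\frac{m-1}{m}\right)$-max edge of $G$ with $d=\deg(x)\ge\deg(y)=e$. Then \[\operatorname{pd}(G)\le n\left(1-\frac{1}{d+\frac{m-1}{m}e+1}\right).\]
   Context: All graphs are finite and simple. For a scalar $\alpha>0$, an edge $(x,y)$ of $G$ (with its endpoints listed in this order) is called $\alpha$-max if it maximizes the quantity $\deg(x)+\alpha\deg(y)$ over all edges of $G$ and both orderings of their endpoints. $K_{1,m+1}$ is the complete bipartite graph with one vertex on one side and $m+1$ on the other. For $G$ with vertex set $\{x_1,\dots,x_n\}$ and a fixed field $\mathbf{k}$, $S=\mathbf{k}[x_1,\dots,x_n]$, $I(G)=(x_ix_j:(x_i,x_j)\in E(G))$ is the edge ideal, and $\operatorname{pd}(G)$ is the projective dimension of $S/I(G)$. *)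

(* Defs.v *)
From HB Require Import structures.
From mathcomp Require Import all_boot all_order all_algebra.
From mathcomp Require Import mpoly.
From Stdlib Require Import ClassicalEpsilon.
Set Implicit Arguments. Unset Strict Implicit. Unset Printing Implicit Defensive.
Import Order.TTheory GRing.Theory Num.Theory.
Local Open Scope ring_scope.

Definition pbool (P : Prop) : bool :=
  if excluded_middle_informative P then true else false.

Lemma pboolP (P : Prop) : reflect P (pbool P).
Proof. by rewrite /pbool; case: excluded_middle_informative => h; constructor. Qed.

Definition simple_graph (n : nat) (E : rel 'I_n) : Prop :=
  irreflexive E /\ ssrbool.symmetric E.

Definition deg (n : nat) (E : rel 'I_n) (x : 'I_n) : nat := #|[set y | E x y]|.

(* G contains an induced subgraph isomorphic to K_{1,m+1}: a centre v and an
   independent set A of m+1 neighbours of v. *)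
Definition has_induced_star (n : nat) (E : rel 'I_n) (m : nat) : Prop :=
  exists (v : 'I_n) (A : {set 'I_n}),
    [/\ #|A| = m.+1, {in A, forall a, E v a} &
        {in A &, forall a b, ~~ E a b}].

Definition alpha_max_edge (n : nat) (E : rel 'I_n) (alpha : rat) (x y : 'I_n) : Prop :=
  E x y /\ forall u v, E u v ->
    (deg E u)%:R + alpha * (deg E v)%:R <= (deg E x)%:R + alpha * (deg E y)%:R.

Definition edge_ideal (k : fieldType) (n : nat) (E : rel 'I_n) : pred {mpoly k[n]} :=
  fun p => pbool (exists c : 'I_n -> 'I_n -> {mpoly k[n]},
      p = \sum_(i : 'I_n) \sum_(j : 'I_n | E i j) c i j * ('X_i * 'X_j) ).

(* A finite free resolution of length p of S/I over S:
   0 -> F_p -> ... -> F_1 -> F_0 = S -> S/I -> 0,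
   with F_i = S^(b i) and phi i : F_(i+1) -> F_i acting on column vectors. *)
Definition free_resolution_of_length (k : fieldType) (n : nat)
    (I : pred {mpoly k[n]}) (p : nat) : Prop :=
  exists (b : nat -> nat) (phi : forall i, 'M[{mpoly k[n]}]_(b i, b i.+1)),
    [/\ b 0%N = 1%N, b p.+1 = 0%N,
        (forall v : 'cV[{mpoly k[n]}]_(b 0%N),
            (exists w, v = phi 0%N *m w) <-> (forall i, v i 0 \in I)) &
        (forall i, (i < p)%N -> forall v : 'cV[{mpoly k[n]}]_(b i.+1),
            phi i *m v = 0 <-> exists w, v = phi i.+1 *m w)].

(* projective dimension of S/I: the least length of a finite free resolution
   (exists by Hilbert's syzygy theorem; defaults to 0 otherwise). *)
Definition proj_dim (k : fieldType) (n : nat) (I : pred {mpoly k[n]}) : nat :=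
  match excluded_middle_informative
          (exists p, free_resolution_of_length I p) with
  | left h =>
      @ex_minn (fun p => pbool (free_resolution_of_length I p))
        (let: ex_intro p hp := h in ex_intro _ p (introT (pboolP _) hp))
  | right _ => 0%N
  end.

Definition pd (k : fieldType) (n : nat) (E : rel 'I_n) : nat :=
  proj_dim (@edge_ideal k n E).
Arguments pd k {n} E.

(* Main.v *)
Require Import Defs.
From HB Require Import structures.
From mathcomp Require Import all_boot all_order all_algebra.
From mathcomp Require Import mpoly zify.
From Stdlib Require ClassicalEpsilon.
Import Order.TTheory GRing.Theory Num.Theory.
Local Open Scope ring_scope.

(* If [I' : x] is contained in [I'] and [I'] in [J], then
   [0 -> I' -> I' (+) J -> I' + x J -> 0], with first map [b |-> (- x b, b)], is
   exact, so a mapping cone gives [pd (S/(I' + x J)) <= max (pd (S/I') + 1, pd (S/J))].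
   Applied to a vertex [v] of [G], with [I' = I(G - v)] and
   [J = I(G - N[v]) + (N(v))], this yields
   [pd G <= max (pd (G - v) + 1, pd (G - N[v]) + deg v)]. Put
   [D = deg x + (m - 1)/m * deg y + 1] for the given maximal edge. Delete the
   neighbours of a non-isolated vertex [z] one at a time, in such an order that
   each [v] has at most [(m - 1)/m * deg z] non-neighbours among those deleted
   before it; this is possible because [N(z)] has no independent set of size
   [m + 1]. Branching at [v] then removes at most
   [deg v + 1 + (m - 1)/m * deg z <= D] vertices in total, and induction on the
   number of vertices gives [pd G <= n - n / D]. *)

(** * Free resolutions and mapping cones *)

Section Resolutions.
Variable S : comNzRingType.

(** For a submodule [N] of S^a this says that S^a/[N] has a free resolution of length at most [p]
    starting at S^a; the recursion passes to first syzygies. *)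
Fixpoint resolvable (p a : nat) (N : 'cV[S]_a -> Prop) : Prop :=
  if p is q.+1 then
    exists (b : nat) (phi : 'M[S]_(a, b)),
      (forall v, N v <-> exists w, v = phi *m w) /\
      resolvable q b (fun w => phi *m w = 0)
  else forall v, N v <-> v = 0.
Arguments resolvable p {a} N.

Lemma eq_resolvable (p a : nat) (N N' : 'cV[S]_a -> Prop) :
  (forall v, N v <-> N' v) -> resolvable p N -> resolvable p N'.
Proof.
case: p => [|p] eqN /=; first by move=> h v; rewrite -eqN.
by move=> [b [phi [h r]]]; exists b, phi; split=> // v; rewrite -eqN.
Qed.

Lemma resolvableS (p a : nat) (N : 'cV[S]_a -> Prop) :
  resolvable p N -> resolvable p.+1 N.
Proof.
elim: p a N => [|p IH] a N.
  move=> h; exists 0%N, 0; split=> [v|w]; last by rewrite !flatmx0 mulmx0.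
  rewrite h; split=> [->|[w ->]]; last by rewrite mul0mx.
  by exists 0; rewrite mul0mx.
by move=> [b [phi [h r]]]; exists b, phi; split=> //; apply: IH.
Qed.

Lemma leq_resolvable (p q a : nat) (N : 'cV[S]_a -> Prop) :
  (p <= q)%N -> resolvable p N -> resolvable q N.
Proof.
move=> /subnKC <-; elim: (q - p)%N => [|r IH]; first by rewrite addn0.
by move=> /IH/resolvableS; rewrite addnS.
Qed.

(** The quotient is zero, but the resolution starts at S^a, so the identity has to cancel it in
    degree one. *)
Lemma resolvable_full (a p : nat) :
  resolvable p.+1 (fun _ : 'cV[S]_a => True).
Proof.
apply: (@leq_resolvable 1) => //; exists a, 1%:M; split=> v; last by rewrite mul1mx.
by split=> // _; exists v; rewrite mul1mx.
Qed.

Lemma resolvable_dsum (p a b : nat) (N : 'cV[S]_a -> Prop) (N' : 'cV[S]_b -> Prop) :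
  resolvable p N -> resolvable p N' ->
  resolvable p (fun v : 'cV[S]_(a + b) => N (usubmx v) /\ N' (dsubmx v)).
Proof.
elim: p a b N N' => [|p IH] a b N N' /=.
  move=> hN hN' v; rewrite hN hN'; split=> [[u0 d0]|->].
    by rewrite -[v]vsubmxK u0 d0 col_mx0.
  by rewrite !linear0.
move=> [c [phi [h r]]] [c' [phi' [h' r']]].
exists (c + c')%N, (block_mx phi 0 0 phi'); split=> [v|].
  rewrite h h'; split=> [[[w hw] [w' hw']]|[w ->]].
    exists (col_mx w w'); rewrite mul_block_col !mul0mx addr0 add0r -hw -hw'.
    by rewrite vsubmxK.
  rewrite -[w]vsubmxK mul_block_col !mul0mx addr0 add0r col_mxKu col_mxKd.
  by split; eexists.
apply: eq_resolvable (IH _ _ _ _ r r') => w.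
rewrite -{3}[w]vsubmxK mul_block_col !mul0mx addr0 add0r.
split=> [[-> ->]|]; first by rewrite col_mx0.
by move=> /(congr1 (fun v => (usubmx v, dsubmx v))); rewrite col_mxKu col_mxKd !linear0 => -[-> ->].
Qed.

(** Free modules are projective: preimages under [B] of the columns of [A] form the columns of
    [h]. *)
Lemma lift_columns (a b c : nat) (A : 'M[S]_(a, b)) (B : 'M[S]_(a, c)) :
  (forall u : 'cV[S]_b, exists w : 'cV[S]_c, A *m u = B *m w) ->
  exists h, A = B *m h.
Proof.
move=> AB; have [h hP] := fin_all_exists (fun j => AB (delta_mx j 0)).
exists (\matrix_(i, j) h j i 0); apply/matrixP=> i j.
have /matrixP/(_ i 0) := hP j; rewrite -colE mxE => ->.
by rewrite !mxE; apply: eq_bigr => l _; rewrite mxE.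
Qed.

(* Mapping cone of a lift of [f] to resolutions of [N1] and [N2]. *)
Lemma resolvable_cone (p q a b c : nat) (N1 : 'cV[S]_a -> Prop)
    (N2 : 'cV[S]_b -> Prop) (f : 'M[S]_(b, a)) (g : 'M[S]_(c, b)) :
  resolvable p N1 -> resolvable q N2 ->
  (forall u, N1 u -> f *m u = 0 -> u = 0) ->
  (forall v, N2 v /\ g *m v = 0 <-> exists2 u, N1 u & v = f *m u) ->
  resolvable (maxn p.+1 q) (fun z => exists2 v, N2 v & z = g *m v).
Proof.
elim: p q a b c N1 N2 f g => [|p IH] [|q] a b c N1 N2 f g.
- move=> _ h2 _ _; apply: (@leq_resolvable 0) => //= z; split.
    by move=> [v /h2 -> ->]; rewrite mulmx0.
  by move=> ->; exists 0; [apply/h2 | rewrite mulmx0].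
(* With [N1] zero, [g] is injective on [N2], so composing with [g] turns the resolution of [N2] into
   one of its image. *)
- move=> h1 [d [phi [h2 r2]]] _ fg; rewrite maxnSS max0n.
  exists d, (g *m phi); split.
    move=> z; split=> [[v /h2[w ->] ->]|[w ->]]; first by exists w; rewrite mulmxA.
    by exists (phi *m w); rewrite ?mulmxA //; apply/h2; exists w.
  apply: eq_resolvable r2 => w; rewrite -mulmxA; split=> [->|gw0].
    by rewrite mulmx0.
  have [|u /h1 -> ->] := (fg (phi *m w)).1; last by rewrite mulmx0.
  by split=> //; apply/h2; exists w.
- move=> _ h2 _ _; apply: (@leq_resolvable 0) => //= z; split.
    by move=> [v /h2 -> ->]; rewrite mulmx0.
  by move=> ->; exists 0; [apply/h2 | rewrite mulmx0].
move=> [a' [psi [h1 r1]]] [d [phi [h2 r2]]] finj fg; rewrite maxnSS.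
exists d, (g *m phi); split.
  move=> z; split=> [[v /h2[w ->] ->]|[w ->]]; first by exists w; rewrite mulmxA.
  by exists (phi *m w); rewrite ?mulmxA //; apply/h2; exists w.
(* [h] is the degree-one component of a chain map lifting [f]. *)
have [h hP] : exists h, f *m psi = phi *m h.
  apply: lift_columns => u; apply/h2; rewrite -mulmxA.
  by apply: ((fg _).2 _).1; exists (psi *m u) => //; apply/h1; exists u.
have fpsi u : phi *m (h *m u) = f *m (psi *m u) by rewrite !mulmxA hP.
have N1psi u : N1 (psi *m u) by apply/h1; exists u.
(* The kernel of [g *m phi] is the image of ker [phi] (+) S^a' under (w, u) |-> w + h u, and the
   pairs sent to zero are the (- h u, u) with [psi *m u = 0]. This is again the situation of the
   lemma; the length one spent on the full summand is absorbed by [p.+1]. *)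
have r2' : resolvable (maxn q 1)
    (fun v : 'cV[S]_(d + a') => phi *m usubmx v = 0 /\ True).
  apply: (@resolvable_dsum _ _ _ (fun v => phi *m v = 0) (fun=> True)).
    by apply: leq_resolvable r2; rewrite leq_maxl.
  by rewrite maxnC; case: (q) => [|q']; rewrite ?maxn0 ?maxnSS; apply: resolvable_full.
have := IH _ _ _ d _ _ (col_mx (- h) 1%:M) (row_mx 1%:M h) r1 r2'.
rewrite maxnCA (maxn_idPl (_ : 1 <= p.+1)%N) // [maxn q _]maxnC => cone.
apply: eq_resolvable (cone _ _) => [w|u _|v].
- rewrite -mulmxA; split=> [[v [v0 _] ->]|gw0].
    rewrite -[v in row_mx _ _ *m v]vsubmxK mul_row_col mul1mx mulmxDr v0 add0r fpsi.
    by apply: ((fg _).2 _).2; exists (psi *m dsubmx v).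
  have [|u /h1[u' ->] wu] := (fg (phi *m w)).1.
    by split=> //; apply/h2; exists w.
  exists (col_mx (w - h *m u') u').
    by rewrite col_mxKu mulmxBr wu fpsi subrr.
  by rewrite mul_row_col mul1mx subrK.
- rewrite mul_col_mx mul1mx => /(congr1 dsubmx).
  by rewrite col_mxKd linear0.
split=> [[[v0 _]]|[u psiu0 ->]].
  rewrite -{1}[v]vsubmxK mul_row_col mul1mx => /eqP; rewrite addr_eq0 => /eqP uv.
  exists (dsubmx v); last by rewrite mul_col_mx mul1mx mulNmx -uv vsubmxK.
  apply: finj => //; rewrite -fpsi; apply: oppr_inj.
  by rewrite -mulmxN -uv v0 oppr0.
rewrite mul_col_mx col_mxKu mul_row_col !mul1mx mulNmx addNr; split=> //; split=> //.
by rewrite mulmxN fpsi psiu0 mulmx0 oppr0.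
Qed.

Definition ideal_resolvable (p : nat) (I : S -> Prop) : Prop :=
  resolvable p (fun v : 'cV[S]_1 => I (v 0 0)).

Lemma ideal_resolvable_addM (p q : nat) (x : S) (I I' J : S -> Prop) :
  (forall a, I' a -> I' (- (x * a))) ->
  (forall a, I' (- (x * a)) -> I' a) ->
  (forall a, I' a -> J a) ->
  (forall c, I c <-> exists a b, [/\ I' a, J b & c = a + x * b]) ->
  ideal_resolvable p I' -> ideal_resolvable q J ->
  ideal_resolvable (maxn p.+1 q) I.
Proof.
move=> I'M I'x I'J IE rI' rJ.
have r2 : resolvable (maxn p q)
    (fun v : 'cV[S]_(1 + 1) => I' (usubmx v 0 0) /\ J (dsubmx v 0 0)).
  apply: (@resolvable_dsum _ _ _ (fun v => I' (v 0 0)) (fun v => J (v 0 0))).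
    by apply: leq_resolvable rI'; rewrite leq_maxl.
  by apply: leq_resolvable rJ; rewrite leq_maxr.
have := @resolvable_cone _ _ _ _ 1 _ _ (col_mx (- x%:M) 1%:M) (row_mx 1%:M x%:M) rI' r2.
rewrite maxnA (maxn_idPl (leqnSn p)) => cone.
apply: eq_resolvable (cone _ _) => [v|u _|v].
- rewrite IE; split=> [[w [w1 w2] ->]|[a [b [aI bJ vE]]]].
    exists (usubmx w 0 0), (dsubmx w 0 0); split=> //.
    rewrite -[w in row_mx _ _ *m w]vsubmxK mul_row_col mul1mx mul_scalar_mx.
    by rewrite mxE [X in _ + X]mxE.
  exists (col_mx a%:M b%:M).
    by rewrite col_mxKu col_mxKd !mxE.
  by rewrite mul_row_col mul1mx mul_scalar_mx; apply/matrixP=> i j; rewrite !ord1 vE !mxE !mulr1n.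
- rewrite mul_col_mx mul1mx => /(congr1 dsubmx).
  by rewrite col_mxKd linear0.
split=> [[[v1 v2]]|[u uI' ->]].
  rewrite -{1}[v]vsubmxK mul_row_col mul1mx => /eqP; rewrite addr_eq0 => /eqP uv.
  exists (dsubmx v); last by rewrite mul_col_mx mul1mx mulNmx -uv vsubmxK.
  by apply: I'x; move: v1; rewrite uv mul_scalar_mx !mxE.
rewrite mul_col_mx col_mxKu col_mxKd mul_row_col !mul1mx mulNmx addNr; split=> //.
rewrite mul_scalar_mx; split; last exact: I'J.
by rewrite mxE [X in - X]mxE; apply: I'M.
Qed.

(** Unrolls the recursion into the indexed matrices that [free_resolution_of_length] asks for. The
    first matrix stands apart because its number of rows is prescribed. *)
Lemma resolvable_chain (p a : nat) (N : 'cV[S]_a -> Prop) :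
  resolvable p N ->
  exists (b : nat -> nat) (phi0 : 'M[S]_(a, b 0%N))
    (phi : forall i, 'M[S]_(b i, b i.+1)),
    [/\ b p = 0%N,
        (forall v, N v <-> exists w, v = phi0 *m w),
        ((0 < p)%N -> forall v : 'cV[S]_(b 0%N), phi0 *m v = 0 <-> exists w, v = phi 0%N *m w) &
        (forall i, (i.+1 < p)%N -> forall v : 'cV[S]_(b i.+1),
           phi i *m v = 0 <-> exists w, v = phi i.+1 *m w)].
Proof.
elim: p a N => [|p IH] a N /=.
  move=> h; exists (fun=> 0%N), 0, (fun=> 0); split=> // v; rewrite h.
  split=> [->|[w ->]]; last by rewrite mul0mx.
  by exists 0; rewrite mul0mx.
move=> [b1 [phi1 [h /IH[b [phi0 [phi [b0 e0 e1 e2]]]]]]].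
(* Ranks and matrices are shifted by one; matching on the index makes the dimensions agree by
   computation. *)
pose c i := if i is j.+1 then b j else b1.
pose psi i : 'M[S]_(c i, c i.+1) :=
  match i return 'M[S]_(c i, c i.+1) with 0 => phi0 | j.+1 => phi j end.
exists c, phi1, psi; split=> // -[|i] lt_ip; first exact: e1.
exact: e2.
Qed.

End Resolutions.
Arguments ideal_resolvable {S}.

Lemma pd_leq (k : fieldType) (n : nat) (E : rel 'I_n) (p : nat) :
  ideal_resolvable p (fun c => c \in @edge_ideal k n E) -> (pd k E <= p)%N.
Proof.
move=> /resolvable_chain[b [phi0 [phi [bp e0 e1 e2]]]].
pose c i := if i is j.+1 then b j else 1%N.
pose psi i : 'M[{mpoly k[n]}]_(c i, c i.+1) :=
  match i return 'M_(c i, c i.+1) with 0 => phi0 | j.+1 => phi j end.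
have fr : free_resolution_of_length (@edge_ideal k n E) p.
  exists c, psi; split=> // [v|[|i] lt_ip]; [|exact: e1|exact: e2].
  split=> [/e0 h i|h]; first by rewrite ord1.
  exact/e0/h.
rewrite /pd /proj_dim; case: ClassicalEpsilon.excluded_middle_informative => // h.
by case: ex_minnP => q _; apply; apply/pboolP.
Qed.

(** * Monomial ideals *)

Section MonomialIdeals.
Variables (k : fieldType) (n : nat).
Local Notation S := {mpoly k[n]}.

(** This is a [k]-span of monomials; it is an ideal once [P] is stable under multiplication by
    variables. *)
Definition monomial_ideal (P : pred 'X_{1..n}) (c : S) : Prop :=
  {in msupp c, forall m, P m}.

Lemma msuppXM (v : 'I_n) (c : S) :
  msupp ('X_v * c) =i [seq (U_(v) + m)%MM | m <- msupp c].
Proof. by move=> m; rewrite mulrC; apply/perm_mem/msuppMX. Qed.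

Lemma monomial_ideal0 : ideal_resolvable 0 (monomial_ideal pred0).
Proof.
move=> v; split=> [h|->]; last by move=> m; rewrite mxE msupp0.
apply/matrixP=> i j; rewrite !ord1 mxE; apply/eqP; rewrite -msupp_eq0.
by move: h; rewrite /monomial_ideal; case: (msupp _) => // m s /(_ m (mem_head m s)).
Qed.

Lemma monomial_idealT : ideal_resolvable 1 (monomial_ideal predT).
Proof. by apply: eq_resolvable (resolvable_full S 1 0). Qed.

(** Membership is decided monomial by monomial: invariance of [P'] gives I' : x_v = I', and the
    formula for [P] says I = I' + x_v J. *)
Lemma monomial_ideal_addM (p q : nat) (v : 'I_n) (P P' Q : pred 'X_{1..n}) :
  (forall m, P' (U_(v) + m)%MM = P' m) -> subpred P' Q ->
  (forall m, P m = P' m || (m v != 0%N) && Q (m - U_(v))%MM) ->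
  ideal_resolvable p (monomial_ideal P') ->
  ideal_resolvable q (monomial_ideal Q) ->
  ideal_resolvable (maxn p.+1 q) (monomial_ideal P).
Proof.
move=> P'v P'Q PE; apply: (@ideal_resolvable_addM _ _ _ 'X_v).
- move=> a aP m; rewrite (perm_mem (msuppN _)) msuppXM => /mapP[m' m'a ->].
  by rewrite P'v; apply: aP.
- move=> a aP m ma; rewrite -P'v; apply: aP.
  by rewrite (perm_mem (msuppN _)) msuppXM map_f.
- by move=> a aP m /aP/P'Q.
move=> c; split=> [cP|[a [b [aP bQ ->]]] m].
  (* [a] collects the terms of [c] in I'; every other term is divisible by x_v, and [b] holds the
     quotients. *)
  pose a := \sum_(m <- msupp c | P' m) c@_m *: 'X_[m] : S.
  pose b := \sum_(m <- msupp c | ~~ P' m) c@_m *: 'X_[(m - U_(v))] : S.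
  have cm m : m \in msupp c -> ~~ P' m -> (m v != 0%N) && Q (m - U_(v))%MM.
    by move=> /cP; rewrite PE => /orP[->|].
  exists a, b; split.
  - move=> m /msupp_sum_le/flatten_mapP[m']; rewrite mem_filter => /andP[P'm' _].
    by move=> /msuppZ_le/mem_msuppXP <-.
  - move=> m /msupp_sum_le/flatten_mapP[m']; rewrite mem_filter => /andP[nP' m'c].
    by move=> /msuppZ_le/mem_msuppXP <-; case/andP: (cm _ m'c nP').
  rewrite [LHS]mpolyE (bigID P') /=; congr (_ + _).
  rewrite mulr_sumr big_seq_cond [RHS]big_seq_cond.
  apply: eq_bigr => m /andP[mc nP']; rewrite -scalerAr -mpolyXD addmC submK //.
  by rewrite lep1mP; case/andP: (cm _ mc nP').
move=> /msuppD_le; rewrite mem_cat => /orP[/aP P'm|]; first by rewrite PE P'm.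
rewrite msuppXM => /mapP[m' /bQ Qm' ->]; rewrite PE addmC addmK Qm'.
by rewrite mnmDE mnm1E eqxx addn1 orbT.
Qed.

Lemma eq_monomial_ideal (p : nat) (P Q : pred 'X_{1..n}) :
  P =1 Q -> ideal_resolvable p (monomial_ideal P) ->
  ideal_resolvable p (monomial_ideal Q).
Proof.
by move=> PQ; apply: eq_resolvable => v; split=> h m /h; rewrite PQ.
Qed.

(** * Ideals of induced subgraphs *)

Variable E : rel 'I_n.

(* Monomials of the ideal generated by the variables in [U] and the edges
   of the subgraph induced on [W]. *)
Definition graph_monomial (W U : {set 'I_n}) (m : 'X_{1..n}) : bool :=
  [exists u in U, m u != 0%N] ||
  [exists i in W, exists j in W, [&& E i j, m i != 0%N & m j != 0%N]].

Definition graph_ideal (W U : {set 'I_n}) : S -> Prop :=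
  monomial_ideal (graph_monomial W U).

Lemma graph_monomialP (W U : {set 'I_n}) (m : 'X_{1..n}) :
  reflect ((exists2 u, u \in U & m u != 0%N) \/
           exists i j, [/\ i \in W, j \in W, E i j, m i != 0%N & m j != 0%N])
          (graph_monomial W U m).
Proof.
apply: (iffP orP) => [[]|[]].
- by move=> /exists_inP[u]; left; exists u.
- by move=> /exists_inP[i iW /exists_inP[j jW /and3P[]]]; right; exists i, j.
- by move=> [u uU mu]; left; apply/exists_inP; exists u.
move=> [i [j [iW jW Eij mi mj]]]; right; apply/exists_inP; exists i => //.
by apply/exists_inP; exists j => //; apply/and3P.
Qed.

Lemma graph_monomial_local (W U : {set 'I_n}) (m m' : 'X_{1..n}) :
  {in W :|: U, m =1 m'} -> graph_monomial W U m = graph_monomial W U m'.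
Proof.
have imp (m1 m2 : 'X_{1..n}) : {in W :|: U, m1 =1 m2} ->
    graph_monomial W U m1 -> graph_monomial W U m2.
  move=> e /graph_monomialP[[u uU mu]|[i [j [iW jW Eij mi mj]]]]; apply/graph_monomialP.
    by left; exists u => //; rewrite -e // inE uU orbT.
  by right; exists i, j; rewrite -!e // inE ?iW ?jW.
by move=> e; apply/idP/idP; apply: imp => // i /e.
Qed.

Lemma mnmD1_neq (v i : 'I_n) (m : 'X_{1..n}) : i != v -> (U_(v) + m)%MM i = m i.
Proof. by rewrite mnmDE mnm1E eq_sym => /negPf ->. Qed.

Lemma mnmB1_neq (v i : 'I_n) (m : 'X_{1..n}) : i != v -> (m - U_(v))%MM i = m i.
Proof. by rewrite mnmBE mnm1E eq_sym => /negPf ->; rewrite subn0. Qed.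

Lemma graph_monomialD1 (W U : {set 'I_n}) (v : 'I_n) (m : 'X_{1..n}) :
  v \notin W -> v \notin U ->
  graph_monomial W U (U_(v) + m)%MM = graph_monomial W U m.
Proof.
move=> vW vU; apply: graph_monomial_local => i iWU; apply: mnmD1_neq.
by apply: contraTneq iWU => ->; rewrite inE negb_or vW.
Qed.

Lemma graph_monomialB1 (W U : {set 'I_n}) (v : 'I_n) (m : 'X_{1..n}) :
  v \notin W -> v \notin U ->
  graph_monomial W U (m - U_(v))%MM = graph_monomial W U m.
Proof.
move=> vW vU; apply: graph_monomial_local => i iWU; apply: mnmB1_neq.
by apply: contraTneq iWU => ->; rewrite inE negb_or vW.
Qed.

Lemma graph_ideal_edgeless (W : {set 'I_n}) :
  {in W &, forall i j, ~~ E i j} -> ideal_resolvable 0 (graph_ideal W set0).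
Proof.
move=> noE; apply: eq_monomial_ideal monomial_ideal0 => m.
apply/esym/negbTE/graph_monomialP => -[[u]|[i [j [iW jW Eij _ _]]]].
  by rewrite inE.
by move: (noE i j iW jW); rewrite Eij.
Qed.

(** The variable of an isolated vertex occurs in no generator, so the ideal is unchanged: a vertex
    is gained at no cost in length. *)
Lemma graph_ideal_isolated (p : nat) (W : {set 'I_n}) (y : 'I_n) :
  (forall i, i \in W -> ~~ E y i) -> (forall i, i \in W -> ~~ E i y) ->
  ideal_resolvable p (graph_ideal (W :\ y) set0) ->
  ideal_resolvable p (graph_ideal W set0).
Proof.
move=> yW Wy; apply: eq_monomial_ideal => m.
apply/graph_monomialP/graph_monomialP=> -[[u]|[i [j [iW jW Eij mi mj]]]];
  rewrite ?inE //; right; exists i, j; split=> //.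
- by move: iW; rewrite inE => /andP[].
- by move: jW; rewrite inE => /andP[].
- by rewrite !inE iW andbT; apply: contraTneq Eij => ->; apply: yW.
by rewrite !inE jW andbT; apply: contraTneq Eij => ->; apply: Wy.
Qed.

(** This is the mapping cone with J = S, whose length is one. *)
Lemma graph_ideal_addvar (p : nat) (W U : {set 'I_n}) (v : 'I_n) :
  v \notin W -> v \notin U ->
  ideal_resolvable p (graph_ideal W U) ->
  ideal_resolvable p.+1 (graph_ideal W (v |: U)).
Proof.
move=> vW vU r; rewrite -(maxn_idPl (isT : (1 <= p.+1)%N)).
apply: (monomial_ideal_addM _ _ v _ _ _ _ _ _ r monomial_idealT) => // m.
  exact: graph_monomialD1.
rewrite andbT; apply/graph_monomialP/orP=> [[[u]|h]|[/graph_monomialP[[u uU mu]|h]|mv]].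
- rewrite inE in_set1 => /orP[/eqP->|uU] mu; first by right.
  by left; apply/graph_monomialP; left; exists u.
- by left; apply/graph_monomialP; right.
- by left; exists u => //; rewrite inE uU orbT.
- by right.
by left; exists v => //; rewrite setU11.
Qed.

Lemma graph_ideal_addvars (p : nat) (W U : {set 'I_n}) :
  [disjoint U & W] -> ideal_resolvable p (graph_ideal W set0) ->
  ideal_resolvable (p + #|U|) (graph_ideal W U).
Proof.
move: {2}#|U| (erefl #|U|) => c; elim: c U => [|c IH] U.
  by move/eqP; rewrite cards_eq0 => /eqP->; rewrite cards0 addn0.
move=> Uc UW r; have /card_gt0P[v vU] : (0 < #|U|)%N by rewrite Uc.
have Uv : #|U :\ v| = c by apply/succn_inj; rewrite -Uc (cardsD1 v U) vU.
rewrite Uc addnS -Uv -{2}(setD1K vU); apply: graph_ideal_addvar.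
- by rewrite (disjointFr UW).
- by rewrite setD11.
by apply: IH => //; apply: disjointWl UW; rewrite subD1set.
Qed.

(** The edges at [v] contribute x_v times the variables of N(v), and the edges that generate the
    rest of J already lie in I'; hence I = I' + x_v J. An edge avoiding [v] meets N(v) or lies
    outside N[v]; hence I' is contained in J. *)
Lemma graph_ideal_vertex (p q : nat) (W : {set 'I_n}) (v : 'I_n) :
  simple_graph E -> v \in W ->
  ideal_resolvable p (graph_ideal (W :\ v) set0) ->
  ideal_resolvable q
    (graph_ideal (W :\ v :\: [set u | E v u]) ((W :\ v) :&: [set u | E v u])) ->
  ideal_resolvable (maxn p.+1 q) (graph_ideal W set0).
Proof.
move=> [irrE symE] vW; apply: (monomial_ideal_addM _ _ v) => m.
- by apply: graph_monomialD1; rewrite !inE ?eqxx.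
- move=> /graph_monomialP[[u]|[i [j [iW jW Eij mi mj]]]]; first by rewrite inE.
  apply/graph_monomialP.
  case vi: (E v i); first by left; exists i => //; rewrite inE iW inE.
  case vj: (E v j); first by left; exists j => //; rewrite inE jW inE.
  by right; exists i, j; split=> //; rewrite in_setD inE ?vi ?vj.
(* [v] lies in neither set defining J, so lowering its exponent does not affect membership in J. *)
rewrite graph_monomialB1 ?inE ?eqxx ?andbF //.
apply/graph_monomialP/orP=> [[[u]|[i [j [iW jW Eij mi mj]]]]|]; first by rewrite inE.
  have [iv|niv] := eqVneq i v; [|have [jv|njv] := eqVneq j v].
  - right; subst i; rewrite mi; apply/graph_monomialP; left; exists j => //.
    by rewrite !inE jW Eij !andbT; apply: contraTneq Eij => ->; rewrite irrE.
  - right; subst j; rewrite mj; apply/graph_monomialP; left; exists i => //.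
    by rewrite !inE iW niv symE Eij.
  by left; apply/graph_monomialP; right; exists i, j; rewrite !inE niv njv.
case=> [/graph_monomialP[[u]|]|/andP[mv /graph_monomialP[[u]|]]].
- by rewrite inE.
- move=> [i [j [/setD1P[_ iW] /setD1P[_ jW] Eij mi mj]]].
  by right; exists i, j.
- by rewrite !inE => /andP[/andP[uv uW] vu] mu; right; exists v, u.
move=> [i [j [/setDP[/setD1P[_ iW] _] /setDP[/setD1P[_ jW] _] Eij mi mj]]].
by right; exists i, j.
Qed.

Lemma graph_ideal_edge_ideal (c : S) :
  simple_graph E ->
  graph_ideal setT set0 c <-> c \in @edge_ideal k n E.
Proof.
move=> [irrE _]; split=> [cG|/pboolP[d ->] m].
  pose I (c : S) := exists d : 'I_n -> 'I_n -> S,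
    c = \sum_i \sum_(j | E i j) d i j * ('X_i * 'X_j).
  apply/pboolP; rewrite -/(I c) [c]mpolyE big_seq.
  apply: (big_ind I) => [|_ _ [d1 ->] [d2 ->]|m /cG].
  - by exists (fun _ _ => 0); rewrite big1 // => i _; rewrite big1 // => j _; rewrite mul0r.
  - exists (fun i j => d1 i j + d2 i j); rewrite -big_split; apply: eq_bigr => i _.
    by rewrite -big_split; apply: eq_bigr => j _; rewrite mulrDl.
  move=> /graph_monomialP[[u]|[i0 [j0 [_ _ Eij mi mj]]]]; first by rewrite inE.
  (* The whole term is charged to the edge ([i0], [j0]). Since there are no loops, the exponent of
     [j0] is still positive after division by the variable of [i0]. *)
  exists (fun i j => if (i == i0) && (j == j0)
                     then c@_m *: 'X_[m - U_(i0) - U_(j0)] else 0).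
  rewrite (bigD1 i0) //= (bigD1 j0) //= !eqxx /=.
  rewrite [X in _ + X + _]big1 => [|j /andP[_ /negPf->]]; last by rewrite mul0r.
  rewrite [X in _ + X]big1 => [|i /negPf->]; last by rewrite big1 // => j _; rewrite mul0r.
  rewrite !addr0 -scalerAl -!mpolyXD [(U_(i0) + _)%MM]addmC addmA !submK ?lep1mP //.
  by rewrite mnmB1_neq //; apply: contraTneq Eij => ->; rewrite irrE.
move=> /msupp_sum_le/flatten_mapP[i _] /msupp_sum_le/flatten_mapP[j].
rewrite mem_filter => /andP[Eij _]; rewrite -mpolyXD (perm_mem (msuppMX _ _)).
move=> /mapP[m' _ ->]; apply/graph_monomialP; right; exists i, j.
by rewrite !inE !mnmDE !mnm1E !eqxx; split=> //; rewrite ?addnS // addnC.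
Qed.

End MonomialIdeals.

(** * Large closed neighbourhoods from small independence number *)

(* A maximal independent subset of [B] dominates [B]. *)
Lemma large_closed_neighbourhood (n : nat) (E : rel 'I_n) (m : nat) (B : {set 'I_n}) :
  simple_graph E -> B != set0 ->
  (forall A : {set 'I_n}, A \subset B -> {in A &, forall a b, ~~ E a b} ->
     #|A| != m.+1) ->
  exists2 v, v \in B & (#|B| <= m * #|B :&: (v |: [set u | E v u])|)%N.
Proof.
move=> [irrE symE] /set0Pn[v0 v0B] noindep.
pose Nb v := B :&: (v |: [set u | E v u]).
pose v := [arg max_(v > v0 in B) #|Nb v|]%N.
have [vB vmax] : v \in B /\ forall u, u \in B -> (#|Nb u| <= #|Nb v|)%N.
  by rewrite /v; case: arg_maxnP.
exists v => //.
pose indep (A : {set 'I_n}) :=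
  (A \subset B) && [forall a in A, forall b in A, ~~ E a b].
have indepP A : indep A -> {in A &, forall a b, ~~ E a b}.
  by move=> /andP[_ /forall_inP h] a b /h /forall_inP; apply.
have [A /maxsetP[Aindep Amax] _] : {A | maxset indep A & set0 \subset A}.
  by apply: maxset_exists; rewrite /indep sub0set; apply/forall_inP => a; rewrite inE.
have AB : A \subset B by case/andP: Aindep.
have cardA : (#|A| <= m)%N.
  rewrite leqNgt; apply/negP => ltmA.
  (* Only size exactly [m.+1] is excluded, so a larger independent set is first cut down to it. *)
  have [A' A'A cA'] : exists2 A' : {set 'I_n}, A' \subset A & #|A'| = m.+1.
    have : (0 < #|[set A' : {set 'I_n} | (A' \subset A) && (#|A'| == m.+1)]|)%N.
      by rewrite cards_draws bin_gt0.
    by move=> /card_gt0P[A']; rewrite inE => /andP[? /eqP?]; exists A'.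
  have A'ind : {in A' &, forall a b, ~~ E a b}.
    by move=> a b aA' bA'; apply: (indepP A) => //; apply: (subsetP A'A).
  by have := noindep A' (subset_trans A'A AB) A'ind; rewrite cA' eqxx.
have dom : B \subset \bigcup_(a in A) Nb a.
  apply/subsetP=> u uB; apply/bigcupP; case uA: (u \in A).
    by exists u => //; rewrite !inE uB eqxx.
  have [[a aA Eau]|noa] : (exists2 a, a \in A & E a u) \/ {in A, forall a, ~~ E a u}.
    case: (boolP [exists a in A, E a u]) => [/exists_inP[a]|/exists_inPn]; last by right.
    by left; exists a.
  - by exists a => //; rewrite !inE uB Eau orbT.
  have uAind : indep (u |: A).
    rewrite /indep subUset sub1set uB AB /=.
    apply/forall_inP=> a aU; apply/forall_inP=> b bU; move: aU bU.
    rewrite !inE => /orP[/eqP->|aA] /orP[/eqP->|bA].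
    - by rewrite irrE.
    - by rewrite symE noa.
    - exact: noa.
    exact: (indepP A).
  by move: uA; rewrite -(Amax _ uAind (subsetUr _ _)) setU11.
(* The at most [m] sets [Nb a] cover [B], and each is no larger than [Nb v]. *)
apply: leq_trans (subset_leq_card dom) _.
apply: leq_trans (_ : (\sum_(a in A) #|Nb v| <= _)%N); last first.
  by rewrite sum_nat_const leq_mul2r cardA orbT.
apply: (big_ind2 (fun (X : {set 'I_n}) s => #|X| <= s)%N) => [|X s Y t hX hY|a aA].
- by rewrite cards0.
- by apply: leq_trans (leq_add hX hY); apply: leq_card_setU.
exact/vmax/(subsetP AB).
Qed.

(** * The bound by induction on the vertex set *)

Section Bound.
Variables (k : fieldType) (n : nat) (E : rel 'I_n) (m M : nat).
Hypothesis graphE : simple_graph E.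
Hypothesis m_gt0 : (0 < m)%N.
Hypothesis noStar : ~ has_induced_star E m.
(** [M] stands for m D, with D as in the overview; [le_mM] settles the vertex sets that span no
    edge. *)
Hypothesis le_mM : (m <= M)%N.
Hypothesis edgeM : forall u v, E u v ->
  (m * deg E u + (m - 1) * deg E v + m <= M)%N.

(* The bound is [p <= #|W| (1 - m / M)] with denominators cleared. *)
Lemma graph_ideal_bound (W : {set 'I_n}) :
  exists p, ideal_resolvable p (graph_ideal k n E W set0) /\
            (m * #|W| + M * p <= M * #|W|)%N.
Proof.
have [irrE symE] := graphE.
elim: {W}#|W|.+1 {-2}W (ltnSn #|W|) => // c IH W ltWc.
case: (boolP [exists y in W, exists i in W, E y i]); last first.
  move=> /exists_inPn noE; exists 0%N; rewrite muln0 addn0 leq_mul2r le_mM orbT.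
  split=> //; apply: graph_ideal_edgeless => i j iW jW.
  by have /exists_inPn := noE i iW; apply.
move=> /exists_inP[y yW /exists_inP[x xW Eyx]].
(* [y] is the vertex z of the overview, and [A] consists of its neighbours in [W]. *)
pose N v := [set u | E v u]; pose A := W :&: N y.
have degA : (#|A| <= deg E y)%N by apply/subset_leq_card/subsetIr.
have yA : y \notin A by rewrite !inE irrE andbF.
(* Without [A] the vertex [y] is isolated, so induction applies to [W :\: A :\ y]. The summand
   [#|A|] reserves one unit of length for each vertex to be restored; [edgeM] gives m (|A| + 1) <=
   M, which pays for [A] and [y]. *)
have base : exists p, ideal_resolvable p (graph_ideal k n E (W :\: A) set0) /\
    (m * #|W| + M * (#|A| + p) <= M * #|W|)%N.
  have cW : #|W| = (#|W :\: A :\ y| + #|A|).+1.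
    by rewrite -(cardsID A W) (cardsD1 y (W :\: A)) inE yA yW (setIidPr _) ?subsetIl //; lia.
  have [p [r hp]] := IH (W :\: A :\ y) ltac:(lia).
  exists p; split.
    apply: (graph_ideal_isolated _ _ _ _ _ y) r => i /setDP[iW]; rewrite !inE iW //.
    by rewrite symE.
  have := edgeM _ _ Eyx; rewrite cW; move: hp degA; move: #|_ :\ y| #|A| (deg E y) (deg E x).
  move=> w a d e hp had hM.
  have ma : (m * a <= m * d)%N by rewrite leq_mul2l had orbT.
  nia.
(* The deletions are undone in reverse order: [B] is what is still missing after [i]
   restorations. *)
have step (i : nat) : (i <= #|A|)%N -> exists B : {set 'I_n},
    [/\ B \subset A, #|B| = (#|A| - i)%N &
     exists p, ideal_resolvable p (graph_ideal k n E (W :\: B) set0) /\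
       (m * #|W| + M * (#|B| + p) <= M * #|W|)%N].
  elim: i => [_|i IHi ltiA]; first by exists A; rewrite subn0.
  have [B [BA cB [p [r hp]]]] := IHi (ltnW ltiA).
  (* The vertex [v] restored next has at most (m - 1)/m |B| elements of [B] outside N[v]. *)
  have [|C CB Cind|v vB hv] := large_closed_neighbourhood n E m B graphE.
  - by rewrite -card_gt0 cB subn_gt0.
  (* An independent [C] of size [m.+1] would be the leaves of an induced star centred at [y]. *)
  - apply/eqP => cC; apply: noStar; exists y, C; split=> // a aC.
    by have := subsetP BA a (subsetP CB a aC); rewrite !inE => /andP[].
  have vA := subsetP BA v vB.
  have /setIP[vW] := vA; rewrite inE => Eyv.
  have BW : B \subset W by apply: subset_trans BA (subsetIl _ _).
  exists (B :\ v); split.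
  - exact: subset_trans (subD1set _ _) BA.
  - by have := cardsD1 v B; rewrite vB; lia.
  have eWB : W :\: (B :\ v) :\ v = W :\: B.
    apply/setP=> u; rewrite !inE; have [->|] := eqVneq u v; first by rewrite vB.
    by [].
  pose W' := W :\: B :\: N v; pose U := (W :\: B) :&: N v.
  have cBv : #|B| = #|B :\ v|.+1 by rewrite (cardsD1 v B) vB.
  have cW : #|W| = (#|B| + #|U| + #|W'|)%N.
    by rewrite -(cardsID B W) (setIidPr BW) -(cardsID (N v) (W :\: B)) -/U -/W' addnA.
  have [q [rq hq]] := IH W' ltac:(lia).
  have rJ : ideal_resolvable (q + #|U|) (graph_ideal k n E W' U).
    apply: graph_ideal_addvars rq; rewrite -setI_eq0; apply/eqP/setP=> u.
    by rewrite !inE; case: (E v u); rewrite ?andbF.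
  exists (maxn p.+1 (q + #|U|)); split.
    apply: (graph_ideal_vertex _ _ _ _ _ _ v) => //; rewrite ?eWB //.
    by rewrite !inE eqxx vW.
  (* N[v] contains the disjoint sets B :&: N[v] and [U]. *)
  have degv : (#|B :&: (v |: N v)| + #|U| <= (deg E v).+1)%N.
    have -> : (deg E v).+1 = #|v |: N v| by rewrite cardsU1 inE irrE.
    rewrite -(cardsID B (v |: N v)) setIC leq_add2l.
    by apply/subset_leq_card/subsetP=> u; rewrite !inE => /andP[/andP[-> _] ->]; rewrite orbT.
  have hM : (m * deg E v + (m - 1) * deg E y + m <= M)%N by apply: edgeM; rewrite symE.
  have Bdeg : (#|B| <= deg E y)%N by apply: leq_trans (subset_leq_card BA) degA.
  (* With s = |B :&: N[v]|, from |B| <= m s and s + |U| <= deg v + 1 follows m (|B| + |U|) <= m (deg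
     v + 1) + (m - 1) |B|, and |B| <= deg y. *)
  have key : (m * (#|B| + #|U|) <= M)%N.
    move: hv degv hM Bdeg; move: #|_ :&: _| #|U| (deg E v) (deg E y) #|B|.
    move=> s u d e b hv hd hM hb.
    have h1 : (m * (s + u) <= m * d.+1)%N by rewrite leq_mul2l hd orbT.
    have h2 : ((m - 1) * b <= (m - 1) * e)%N by rewrite leq_mul2l hb orbT.
    nia.
  (* If the branch through N[v] dominates, [key] pays for the |B| + |U| vertices it removes;
     otherwise [v] uses its reserved unit. *)
  case: (leqP p.+1 (q + #|U|)) => _.
    rewrite cW; move: hq key; rewrite cBv.
    by move: #|B :\ v| #|U| #|W'| => b u w; nia.
  by rewrite addnS -addSn -cBv.
have [B [_ cB [p [r hp]]]] := step #|A| (leqnn _).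
move: cB; rewrite subnn => /eqP; rewrite cards_eq0 => /eqP B0.
by exists p; move: r hp; rewrite B0 setD0 cards0.
Qed.
End Bound.

(** * Passage to rational numbers *)

Theorem theorem3p6 (k : fieldType) (n : nat) (E : rel 'I_n) (m : nat)
    (x y : 'I_n) :
  simple_graph E ->
  (0 < m)%N ->
  ~ has_induced_star E m ->
  alpha_max_edge E ((m%:R - 1) / m%:R) x y ->
  (deg E y <= deg E x)%N ->
  ((pd k E)%:R : rat) <=
    n%:R * (1 - 1 / ((deg E x)%:R + (m%:R - 1) / m%:R * (deg E y)%:R + 1)).
Proof.
move=> gE m_gt0 noStar [Exy maxE] _.
have m0 : (m%:R : rat) != 0 by rewrite pnatr_eq0 -lt0n.
(* Multiplying by [m] clears the denominators; [m_gt0] makes the truncated [m - 1] agree with the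
   rational one. *)
have mE u v : (m%:R : rat) * ((deg E u)%:R + (m%:R - 1) / m%:R * (deg E v)%:R) =
    (m * deg E u + (m - 1) * deg E v)%N%:R.
  by rewrite natrD !natrM natrB // mulrDr mulrA [m%:R * (_ / _)]mulrC divfK.
(* [M] is [m] times the denominator in the bound, so [maxE] yields [edgeM]. *)
pose M := (m * deg E x + (m - 1) * deg E y + m)%N.
have M_gt0 : (0 < M)%N by rewrite /M; lia.
have [p [r hp]] : exists p, ideal_resolvable p (graph_ideal k n E setT set0) /\
    (m * #|[set: 'I_n]| + M * p <= M * #|[set: 'I_n]|)%N.
  apply: graph_ideal_bound => //; first by rewrite /M leq_addl.
  move=> u v Euv; rewrite leq_add2r -(ler_nat rat) -!mE.
  by rewrite ler_pM2l ?ltr0n //; apply: maxE.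
have le_pd : (pd k E <= p)%N.
  apply: pd_leq; apply: eq_resolvable r => v; exact: graph_ideal_edge_ideal.
have -> : (deg E x)%:R + (m%:R - 1) / m%:R * (deg E y)%:R + 1 = M%:R / m%:R :> rat.
  by apply: (mulfI m0); rewrite mulrDr mulr1 mE -natrD mulrC divfK.
rewrite div1r invf_div; apply: le_trans (_ : p%:R <= _); first by rewrite ler_nat.
have M0 : (0 : rat) < M%:R by rewrite ltr0n.
rewrite -(ler_pM2l M0) mulrCA mulrBr mulr1 [M%:R * (_ / _)]mulrC divfK ?gt_eqF //.
rewrite mulrBr lerBrDl -!natrM -natrD ler_nat.
by move: hp; rewrite cardsT card_ord; lia.
Qed.
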